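(* For every integer $k\geq 3$ there exists a graph $R_n$ on $n = k^2-1$ vertices with minimum degree $\delta(R_n) = \frac{n-k+1}{k}$ and $k-1$ cut edges.
   Context: All graphs are finite, simple and undirected; a cut edge is an edge whose removal disconnects the graph. *)

(* Defs.v *)
From mathcomp Require Import all_boot all_order all_algebra.

Set Implicit Arguments.
Unset Strict Implicit.
Unset Printing Implicit Defensive.

Record sgraph (T : finType) := SGraph {
  adj : rel T;
  adj_sym : symmetric adj;
  adj_irrefl : irreflexive adj }.

Section SimpleGraphs.
Variable T : finType.
Implicit Types (G : sgraph T) (e : {set T}).

Definition degree G (x : T) : nat := #|[set y | adj G x y]|.

(* The seed #|T| strictly exceeds every degree, so it is never attained when
   T is nonempty. *)
Definition min_degree G : nat := \big[minn/#|T|]_(x : T) degree G x.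

Definition edges G : {set {set T}} :=
  [set [set p.1; p.2] | p : T * T & adj G p.1 p.2].

Definition is_connected G : bool := [forall x, forall y, connect (adj G) x y].

Definition del_adj G e : rel T :=
  [rel x y | adj G x y && ([set x; y] != e)].

Lemma del_adj_sym G e : symmetric (del_adj G e).
Proof. by move=> x y; rewrite /del_adj /= adj_sym setUC. Qed.

Lemma del_adj_irrefl G e : irreflexive (del_adj G e).
Proof. by move=> x; rewrite /del_adj /= adj_irrefl. Qed.

Definition del_edge G e : sgraph T :=
  SGraph (del_adj_sym G e) (del_adj_irrefl G e).

(* "Disconnects" means connected before the removal and not connected after
   it; in particular a disconnected graph has no cut edge. *)
Definition cut_edges G : {set {set T}} :=
  [set e in edges G | is_connected G && ~~ is_connected (del_edge G e)].

End SimpleGraphs.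

(* Main.v *)
Require Import Defs.
From mathcomp Require Import all_boot all_order all_algebra.
From mathcomp Require Import zify ring.

Set Implicit Arguments.
Unset Strict Implicit.
Unset Printing Implicit Defensive.

(** Take a centre of degree [k - 1], joined by one edge to each of [k - 1]
    disjoint cliques, one of order [k] and the others of order [k + 1]; these
    have [1 + k + (k - 2)(k + 1) = k^2 - 1] vertices in total. The edges at the
    centre are bridges, and since [k >= 3] an edge inside a clique lies in a
    triangle, so it is not. *)

Lemma min_degree_eq (T : finType) (G : sgraph T) (c : T) :
  (forall x, degree G c <= degree G x) -> min_degree G = degree G c.
Proof.
move=> c_min; apply/eqP; rewrite eqn_leq; apply/andP; split.
  have: c \in index_enum T by rewrite mem_index_enum.
  rewrite /min_degree; elim: (index_enum T) => //= x r IHr.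
  rewrite inE big_cons => /predU1P[<-|/IHr]; first exact: geq_minl.
  exact: leq_trans (geq_minr _ _).
(* The seed [#|T|] must be bounded below too: a neighbourhood is a subset of [T]. *)
rewrite /min_degree; elim/big_ind: _ => [|m n hm hn|x _]; first exact: max_card.
  by rewrite leq_min hm.
exact: c_min.
Qed.

Section CliqueStar.

(* The cliques are the fibres of [b] away from [c]; the centre [c] is joined to
   the vertex [a i] of the [i]-th one. The value [b c] plays no role. *)
Variables (T I : finType) (c : T) (b : T -> I) (a : I -> T).
Hypothesis (aK : cancel a b) (a_neq_c : forall i, a i != c).

(** As [b] is a left inverse of [a], the test [y == a (b y)] says without a quantifier that [y] lies
    in the image of [a]. *)
Definition clique_star_adj : rel T := fun x y =>
  (x != y) && if x == c then y == a (b y) else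
              if y == c then x == a (b x) else b x == b y.

Lemma clique_star_adj_sym : symmetric clique_star_adj.
Proof.
move=> x y; rewrite /clique_star_adj eq_sym.
by case: (x =P c) (y =P c) => [->|_] [->|_] //; rewrite eq_sym [b x == _]eq_sym.
Qed.

Lemma clique_star_adj_irrefl : irreflexive clique_star_adj.
Proof. by move=> x; rewrite /clique_star_adj eqxx. Qed.

Definition clique_star : sgraph T :=
  SGraph clique_star_adj_sym clique_star_adj_irrefl.

Definition clique (i : I) : {set T} := [set x | (x != c) && (b x == i)].

Lemma clique_star_adj_center x : clique_star_adj c x = (x == a (b x)).
Proof.
rewrite /clique_star_adj eqxx; case: eqP => //= <-.
by rewrite eq_sym (negPf (a_neq_c _)).
Qed.

Lemma clique_star_adj_clique x y : x != c -> y != c ->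
  clique_star_adj x y = (x != y) && (b x == b y).
Proof. by rewrite /clique_star_adj => /negPf-> /negPf->. Qed.

Lemma degree_clique_star_center : degree clique_star c = #|I|.
Proof.
rewrite /degree -(card_imset predT (can_inj aK)); apply: eq_card => x.
rewrite inE /= clique_star_adj_center; apply/eqP/imsetP => [->|[i _ ->]].
  by exists (b x).
by rewrite aK.
Qed.

(** The successor counts [x] itself, which is adjacent to all the rest of its clique. *)
Lemma leq_degree_clique_star x : x != c ->
  #|clique (b x)| <= (degree clique_star x).+1.
Proof.
move=> xc; rewrite (cardsD1 x) inE xc eqxx ltnS.
apply/subset_leq_card/subsetP => y; rewrite !inE => /and3P[yx yc /eqP bxy].
by rewrite /= clique_star_adj_clique // eq_sym yx bxy eqxx.
Qed.

Lemma clique_star_connected : is_connected clique_star.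
Proof.
have cx x : connect clique_star_adj c x.
  have ca : connect clique_star_adj c (a (b x)).
    by apply: connect1; rewrite clique_star_adj_center aK.
  have [->|xc] := eqVneq x c; first exact: connect0.
  have [->//|xa] := eqVneq x (a (b x)).
  apply: connect_trans ca (connect1 _).
  by rewrite clique_star_adj_clique // eq_sym xa aK eqxx.
apply/forallP => x; apply/forallP => y /=; apply: connect_trans (cx y).
by rewrite (sym_connect_sym clique_star_adj_sym).
Qed.

(** Once the spoke is deleted no edge leaves [clique i], a set that contains [a i] but not [c]. *)
Lemma clique_star_spoke_cut i : [set c; a i] \in cut_edges clique_star.
Proof.
rewrite inE clique_star_connected /=; apply/andP; split.
  apply/imsetP; exists (c, a i) => //.
  by rewrite inE /= clique_star_adj_center aK.
apply/negP => /forallP/(_ (a i))/forallP/(_ c) /= conn.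
have clo : closed (del_adj clique_star [set c; a i]) (clique i).
  apply: intro_closed; first exact/sym_connect_sym/del_adj_sym.
  move=> u v /andP[/= uv ne]; rewrite !inE => /andP[uc /eqP bu].
  have [vc|vc] := eqVneq v c.
    case/negP: ne; move: uv; rewrite vc clique_star_adj_sym.
    by rewrite clique_star_adj_center bu => /eqP->; rewrite setUC.
  by move: uv; rewrite clique_star_adj_clique // => /andP[_ /eqP<-]; rewrite bu /=.
by have := closed_connect clo conn; rewrite !inE a_neq_c aK !eqxx.
Qed.

Hypothesis clique_gt2 : forall i, 2 < #|clique i|.

(** A third vertex [z] of the clique gives the detour [x], [z], [y], which replaces the deleted edge
    in any walk. *)
Lemma clique_edge_not_cut x y : x != c -> y != c ->
  clique_star_adj x y -> is_connected (del_edge clique_star [set x; y]).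
Proof.
move=> xc yc xy; pose D := del_adj clique_star [set x; y].
have /andP[xNy /eqP bxy] : (x != y) && (b x == b y).
  by rewrite -clique_star_adj_clique.
have [z zB] : exists z, z \in clique (b x) :\: [set x; y].
  apply/set0Pn; rewrite -card_gt0 cardsD subn_gt0.
  apply: leq_ltn_trans (clique_gt2 (b x)).
  by apply: leq_trans (subset_leq_card (subsetIr _ _)) _; rewrite cards2 xNy.
move: zB; rewrite !inE negb_or => /andP[/andP[zx zy] /andP[zc /eqP bz]].
have zNe u : ([set u; z] == [set x; y]) = false.
  apply/eqP => /setP/(_ z); rewrite !inE eqxx orbT => /esym.
  by rewrite (negPf zx) (negPf zy).
have Dxz : D x z.
  by rewrite /D /del_adj /= zNe andbT clique_star_adj_clique // eq_sym zx bz /=.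
have Dyz : D y z.
  by rewrite /D /del_adj /= zNe andbT clique_star_adj_clique // eq_sym zy bz bxy /=.
have Dsym : symmetric D by exact: del_adj_sym.
have conn_xy : connect D x y.
  by apply: connect_trans (connect1 Dxz) (connect1 _); rewrite Dsym.
have conn_yx : connect D y x.
  by apply: connect_trans (connect1 Dyz) (connect1 _); rewrite Dsym.
have sub : subrel (connect clique_star_adj) (connect D).
  apply: connect_sub => u v uv.
  have [euv|nuv] := eqVneq [set u; v] [set x; y]; last first.
    by apply: connect1; rewrite /D /del_adj /= uv nuv.
  have : u \in [set x; y] by rewrite -euv set21.
  have : v \in [set x; y] by rewrite -euv set22.
  by rewrite !inE => /orP[]/eqP-> /orP[]/eqP->.
apply/forallP => u; apply/forallP => v; apply: sub.
exact: (forallP (forallP clique_star_connected u) v).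
Qed.

Lemma cut_edges_clique_star :
  cut_edges clique_star = [set [set c; a i] | i in I].
Proof.
apply/setP => e; apply/idP/imsetP => [|[i _ ->]]; last exact: clique_star_spoke_cut.
rewrite inE => /and3P[/imsetP[[x y] /=]]; rewrite inE /= => xy -> _ ncon.
have [xc|xc] := eqVneq x c.
  move: xy; rewrite xc clique_star_adj_center => /eqP ya.
  by exists (b y); rewrite // -ya.
have [yc|yc] := eqVneq y c.
  move: xy; rewrite yc clique_star_adj_sym clique_star_adj_center => /eqP xa.
  by exists (b x); rewrite // -xa setUC.
by case/negP: ncon; apply: clique_edge_not_cut.
Qed.

Lemma card_cut_edges_clique_star : #|cut_edges clique_star| = #|I|.
Proof.
(* Distinct indices give distinct spokes: [a i] is an end of the spoke at [a j] and is not [c], so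
   it equals [a j]. *)
rewrite cut_edges_clique_star card_imset // => i j /setP/(_ (a i)).
rewrite !inE eqxx orbT (negPf (a_neq_c i)) /= => /esym/eqP.
exact: (can_inj aK).
Qed.

End CliqueStar.

Theorem theorem3p3 (k : nat) (hk : 3 <= k) :
  let n := k ^ 2 - 1 in
  exists G : sgraph 'I_n,
    ((min_degree G)%:R = (n%:R - k%:R + 1) / k%:R :> rat)%R
    /\ #|cut_edges G| = k - 1.
Proof.
(* The vertices split into [k - 1] blocks of [k.+1] consecutive integers, and [b] is the block
   number. *)
move=> n; have nE : n = (k - 1) * k.+1 by rewrite /n; nia.
have n_gt0 : 0 < n by nia.
have b_lt (x : 'I_n) : x %/ k.+1 < k - 1 by rewrite ltn_divLR // -nE.
have v_lt (i : 'I_(k - 1)) j : j <= k -> i * k.+1 + j < n.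
  by move=> jk; have := ltn_ord i; rewrite nE; nia.
(* The centre is the vertex 0, so block 0 loses one vertex to it. Attaching each spoke at the last
   vertex of its block, offset [k], keeps [a i] away from [c]. *)
pose c := Ordinal n_gt0; pose b x := Ordinal (b_lt x).
pose a i := Ordinal (v_lt i k (leqnn k)).
have bE (i : 'I_(k - 1)) j (jk : j <= k) : b (Ordinal (v_lt i j jk)) = i.
  by apply: val_inj; rewrite /= divnMDl // divn_small // addn0.
have aK : cancel a b by move=> i; apply: bE.
have a_neq_c i : a i != c by rewrite -val_eqE /=; lia.
have card_clique i : k <= #|clique c b i|.
  (* Offsets 1 to [k] avoid the centre in every block, so block 0 needs no separate case. *)
  pose f (j : 'I_k) := Ordinal (v_lt i j.+1 (ltn_ord j)).
  have f_inj : injective f.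
    by move=> j l /(congr1 val) /= /eqP; rewrite eqn_add2l => /eqP[/val_inj].
  rewrite -[X in X <= _]card_ord -(card_imset predT f_inj).
  apply/subset_leq_card/subsetP => _ /imsetP[j _ ->].
  by rewrite inE bE eqxx andbT -val_eqE /=; lia.
have clique_gt2 i : 2 < #|clique c b i| by apply: leq_trans (card_clique i).
exists (clique_star c b a); split; last first.
  by rewrite card_cut_edges_clique_star // card_ord.
rewrite (@min_degree_eq _ _ c); last first.
  move=> x; have [->//|xc] := eqVneq x c.
  rewrite degree_clique_star_center // card_ord.
  rewrite leq_subLR add1n.
  exact: leq_trans (card_clique (b x)) (leq_degree_clique_star b a xc).
rewrite degree_clique_star_center // card_ord.
have k_neq0 : (k%:R != 0 :> rat)%R by rewrite Num.Theory.pnatr_eq0; lia.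
(* With denominators cleared, this is [(k - 1) * k = (k - 1) * (k + 1) - k + 1]; the truncated
   [k - 1] passes to [rat] because [1 <= k]. *)
apply: (GRing.mulIf k_neq0); rewrite GRing.divfK // nE.
rewrite GRing.natrM GRing.natrB; last lia.
by rewrite -GRing.natr1; ring.
Qed.
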